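(* Let $\mathcal{X}$ be a metric space and let $\mathcal{Y}$ be a normed space (over $\mathbb{R}$ or $\mathbb{C}$) which is at least one-dimensional. Equip the set $\mathcal{C}(\mathcal{X},\mathcal{Y})$ of continuous mappings $\mathcal{X}\to\mathcal{Y}$ with the compact-open topology. Then the following statements are equivalent: (i) every dense subset of $\mathcal{C}(\mathcal{X},\mathcal{Y})$ is also sequentially dense; (ii) $\mathcal{X}$ is hemicompact; (iii) $\mathcal{C}(\mathcal{X},\mathcal{Y})$ is a Fréchet-Urysohn space.
   Context: The compact-open topology on $\mathcal{C}(\mathcal{X},\mathcal{Y})$ is the coarsest topology containing all sets $\{G\in\mathcal{C}(\mathcal{X},\mathcal{Y}): G(K)\subseteq V\}$ with $K\subseteq\mathcal{X}$ compact and $V\subseteq\mathcal{Y}$ open. A subset $S$ of a topological space $\mathcal{Z}$ is dense if every open neighborhood of every point of $\mathcal{Z}$ meets $S$; it is sequentially dense if for every $z\in\mathcal{Z}$ there is a sequence in $S$ converging to $z$. A topological space $\mathcal{Z}$ is a Fréchet-Urysohn space if for every $S\subseteq\mathcal{Z}$ and every $z\in\overline{S}$ there is a sequence in $S$ converging to $z$. A topological space $\mathcal{X}$ is hemicompact if there is a sequence $(K_n)_{n\in\mathbb{N}}$ of compact subsets of $\mathcal{X}$ such that each compact $K\subseteq\mathcal{X}$ is contained in some $K_n$. *)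

(* Defs.v *)
From HB Require Import structures.
From mathcomp Require Import all_boot all_order all_algebra.
From mathcomp Require Import all_classical all_reals all_analysis.
From mathcomp Require Import complex.

Set Implicit Arguments.
Unset Strict Implicit.
Unset Printing Implicit Defensive.

Import Order.TTheory GRing.Theory Num.Theory.

Local Open Scope classical_set_scope.

(* C(X, Y) carries the subspace topology inherited from the library's
   compact-open topology on all functions X -> Y.  The lemmas [cts_co_open] and
   [cts_co_coarsest] show that it is the coarsest topology in which every
   [set G | G @` K `<=` V], K compact and V open, is open. *)
Definition cts_co (X Y : topologicalType) : Type :=
  initial_topology (id : continuousType X Y -> {compact-open, X -> Y}).

HB.instance Definition _ (X Y : topologicalType) :=
  Topological.copy (cts_co X Y)
    (initial_topology (id : continuousType X Y -> {compact-open, X -> Y})).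

Definition to_cts {X Y : topologicalType} (G : cts_co X Y) :
  continuousType X Y := G.

Lemma cts_co_open (X Y : topologicalType) (K : set X) (V : set Y) :
  compact K -> open V -> open [set G : cts_co X Y | to_cts G @` K `<=` V].
Proof.
move=> cK oV; exists [set g : {compact-open, X -> Y} | g @` K `<=` V] => //.
exact: compact_open_open.
Qed.

Lemma cts_co_coarsest (X Y T : topologicalType) (f : T -> cts_co X Y) :
  (forall (K : set X) (V : set Y), compact K -> open V ->
    open (f @^-1` [set G | to_cts G @` K `<=` V])) ->
  continuous f.
Proof.
move=> fo; apply/continuousP => _ [A oA <-].
suff fc : continuous (f : T -> {compact-open, X -> Y}).
  by move/continuousP : fc; apply.
move=> t; apply/compact_open_cvgP => K V cK oV fKV.
exact: (open_nbhs_nbhs (conj (fo K V cK oV) fKV)).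
Qed.

Definition sequentially_dense (Z : topologicalType) (S : set Z) : Prop :=
  forall z : Z, exists u : nat -> Z, (forall n, S (u n)) /\ u @ \oo --> z.

Definition frechet_urysohn (Z : topologicalType) : Prop :=
  forall (S : set Z) (z : Z), closure S z ->
    exists u : nat -> Z, (forall n, S (u n)) /\ u @ \oo --> z.

Definition hemicompact (X : topologicalType) : Prop :=
  exists K : nat -> set X, (forall n, compact (K n)) /\
    forall C : set X, compact C -> exists n, C `<=` K n.

(* Main.v *)
(* (i) => (ii): call a family of open sets a k-cover if every compact set lies
   in a member.  Condition (i), applied to the functions that are constantly
   equal to a fixed nonzero vector off some member of a k-cover, yields a
   sequence of members that eventually contain each compact set.  Two
   applications to complements of one or two points show that X is locally
   compact; one more, to the k-cover by relatively compact open sets, shows that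
   X is hemicompact.
   (ii) => (iii): countably many compact sets and a countable base of entourages
   of Y give a countable base of neighbourhoods at each point of C(X, Y). *)

Require Import Defs.
From HB Require Import structures.
From mathcomp Require Import all_boot all_order all_algebra.
From mathcomp Require Import all_classical all_reals all_analysis.
From mathcomp Require Import complex.

Import Order.TTheory GRing.Theory Num.Theory.
Import numFieldNormedType.Exports.

Local Open Scope classical_set_scope.
Local Open Scope ring_scope.

(** * Convergence in the compact-open topology, and hemicompactness *)

Lemma cts_co_cvgP (X Y : topologicalType) (I : Type) (F : set_system I)
    (f : I -> cts_co X Y) (g : cts_co X Y) : Filter F ->
  f @ F --> g <->
  forall (K : set X) (V : set Y), compact K -> open V ->
    to_cts g @` K `<=` V -> \forall i \near F, to_cts (f i) @` K `<=` V.
Proof.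
move=> FF; split=> [fg K V cK oV gKV|fg].
  exact: (fg _ (open_nbhs_nbhs (conj (cts_co_open cK oV) gKV))).
have idfg : (fun i => to_cts (f i) : {compact-open, X -> Y}) @ F
    --> (to_cts g : {compact-open, X -> Y}).
  by apply/compact_open_cvgP => K V cK oV gKV; exact: fg.
move=> A [_ [[B oB <-] Bg] BA].
by apply: filterS BA _; exact: (idfg _ (open_nbhs_nbhs (conj oB Bg))).
Qed.

(** Since the limit [g] is continuous, compact-open convergence to it is uniform convergence on
    compact sets. *)
Lemma cts_co_cvg_uniformP (X : topologicalType) (Y : puniformType) (I : Type)
    (F : set_system I) (f : I -> cts_co X Y) (g : cts_co X Y) : Filter F ->
  f @ F --> g <->
  forall (K : set X) (E : set (Y * Y)), compact K -> entourage E ->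
    \forall i \near F, forall x, K x -> E (to_cts g x, to_cts (f i) x).
Proof.
move=> FF.
pose h i : X -> Y := to_cts (f i).
have hF : Filter (h @ F) by exact: fmap_filter.
have famP := compact_open_fam_compactP (@cts_fun _ _ (to_cts g)) hF.
have coP := compact_open_cvgP (to_cts g : {compact-open, X -> Y}) hF.
split=> [/cts_co_cvgP fg K E cK entE|fg].
  have /famP/fam_cvgP/(_ K cK) : {compact-open, h @ F --> (to_cts g : X -> Y)}.
    by apply/coP => K' V cK' oV gKV; exact: fg.
  move=> /(_ [set q | forall x, K x -> E (to_cts g x, q x)]); apply.
  by apply/uniform_nbhs; exists E; split.
apply/cts_co_cvgP => K V cK oV gKV.
have : {compact-open, h @ F --> (to_cts g : X -> Y)}.
  apply/famP/fam_cvgP => K' cK' P /uniform_nbhs[E [entE EP]].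
  by apply: filterS (fg K' E cK' entE) => i gfi; exact: EP.
by move/coP; exact.
Qed.

Lemma hemicompact_frechet_urysohn (X : topologicalType) (Y : puniformType) :
  countable_uniformity Y -> hemicompact X -> frechet_urysohn (cts_co X Y).
Proof.
move=> /countable_uniformityP[E Esub entE] [K [cK Kcof]] S g clSg.
(* Only the first [n.+1] compact sets and entourages are involved, so [W n] is a neighbourhood of
   [g]. The [W n] decrease, so [u n] in [W n] gives convergence. *)
pose W n := [set f : cts_co X Y | forall m, (m < n.+1)%N ->
  forall x, K m x -> forall k, (k < n.+1)%N -> E k (to_cts g x, to_cts f x)].
have gW n : nbhs g (W n).
  have near_mk m k : \forall f \near g,
      forall x, K m x -> E k (to_cts g x, to_cts f x).
    have /cts_co_cvg_uniformP : (id : cts_co X Y -> _) @ nbhs g --> g by [].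
    by apply; [exact: cK | exact: entE].
  have : \forall f \near g, forall (m k : 'I_n.+1) x, K m x ->
      E k (to_cts g x, to_cts f x).
    pose P (m k : 'I_n.+1) := [set f : cts_co X Y | forall x, K m x ->
      E k (to_cts g x, to_cts f x)].
    have FG : Filter (nbhs g) := nbhs_filter g.
    apply: (@filter_forall _ _ (fun m => [set f | forall k, P m k f]) _ FG) => m.
    by apply: (@filter_forall _ _ (P m) _ FG) => k; exact: near_mk.
  apply: filterS => f Wf m mn x Kx k kn.
  exact: (Wf (Ordinal mn) (Ordinal kn)).
have /choice[u uSW] : forall n, exists f, (S `&` W n) f.
  by move=> n; exact: (clSg _ (gW n)).
exists u; split=> [n|]; first by have [] := uSW n.
apply/cts_co_cvg_uniformP => C A cC entA.
have [m CK] := Kcof C cC; have [k EA] := Esub A entA.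
exists (maxn m k) => // n /=; rewrite geq_max => /andP[mn kn] x Cx.
have [_ Wu] := uSW n.
by apply: EA; exact: (Wu m mn x (CK x Cx) k kn).
Qed.

Lemma frechet_urysohn_dense (Z : topologicalType) (S : set Z) :
  frechet_urysohn Z -> dense S -> sequentially_dense S.
Proof.
move=> FU dS z; apply: FU => B; rewrite nbhsE => -[U [oU Uz] UB].
have [|w [Uw Sw]] := dS U _ oU; first by exists z.
by exists w; split=> //; exact: UB.
Qed.

(** * Selecting sequences from k-covers *)

(** The tail filter of the compact sets directed by inclusion: limits along it are limits of nets
    indexed by compact sets. *)
Definition compact_cofinal (X : topologicalType) : set_system (set X) :=
  filter_from (@compact X) (fun C => [set D | compact D /\ C `<=` D]).

#[global] Instance compact_cofinal_filter (X : topologicalType) :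
  ProperFilter (compact_cofinal X).
Proof.
apply: filter_from_proper => [|C cC]; last first.
  by exists C; split.
apply: filter_from_filter => [|C D cC cD].
  by exists set0; exact: compact0.
exists (C `|` D); first exact: compactU.
by move=> B [cB]; rewrite subUset => -[CB DB].
Qed.

Definition k_cover (X : topologicalType) (U : set (set X)) :=
  (forall A, U A -> open A) /\
  forall K, compact K -> exists2 A, U A & K `<=` A.

(** An analogue, with compact sets in place of finite ones, of the Gerlits-Nagy gamma-property. *)
Definition k_sequence_property (X : topologicalType) :=
  forall U : set (set X), k_cover X U ->
    exists u : nat -> set X, (forall n, U (u n)) /\
      forall K, compact K -> \forall n \near \oo, K `<=` u n.

(** A neighbourhood of the limit absorbs all but finitely many terms, and the finite rest is
    compact. *)
Lemma compact_range_cvg (X : topologicalType) (y : nat -> X) (x : X) :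
  y @ \oo --> x -> compact ([set x] `|` range y).
Proof.
move=> yx; apply/compact_near_coveringP => I F P FF cov.
have [[V B] /= [Vx FB] VBP] := cov x (or_introl erefl).
have [N _ yV] := yx _ Vx.
have cfin : compact (y @` `I_N).
  by apply: finite_compact; apply: finite_image; exact: finite_II.
have A2 : \near F, y @` `I_N `<=` P F.
  apply: (compact_near_coveringP _).1 cfin _ _ _ FF _.
  by move=> _ [n _ <-]; apply: cov; right; exists n.
apply: filterS2 FB A2 => i Bi Ai _ [->|[n _ <-]].
  by apply: (VBP (x, i)); split=> //; exact: nbhs_singleton.
have [nN|Nn] := ltnP n N; first by apply: Ai; exists n.
by apply: (VBP (y n, i)); split=> //; exact: yV.
Qed.

(** The complements of single points of [B] form a k-cover, as no compact set contains [B]. *)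
Lemma k_sequence_avoid (X : topologicalType) (B : set X) :
  accessible_space X -> k_sequence_property X ->
  (forall C, compact C -> ~ B `<=` C) ->
  exists y : nat -> X, (forall n, B (y n)) /\
    forall C, compact C -> \forall n \near \oo, ~ C (y n).
Proof.
move=> T1 kX BC.
have [|u [Bu uC]] := kX [set ~` [set y] | y in B].
  split=> [_ [y _ <-]|C cC].
    by rewrite openC; exact: accessible_closed_set1.
  have /existsNP[y /not_implyP[By nCy]] := BC C cC.
  by exists (~` [set y]); [exists y | move=> c Cc /= cy; rewrite -cy in nCy].
have /choice[y yP] : forall n, exists y, B y /\ ~` [set y] = u n.
  by move=> n; have [y By yu] := Bu n; exists y.
exists y; split=> [n|C cC]; first by have [] := yP n.
apply: filterS (uC C cC) => n Cu Cy.
by have [_ yu] := yP n; have := Cu _ Cy; rewrite -yu; exact.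
Qed.

(* If no neighbourhood of x is compact, each ball of radius 1/(m+1) about x
   contains points avoiding every given compact set.  Let z escape all compact
   sets.  The complements of the pairs {z m, y}, with y in the m-th ball, form
   a k-cover; along a k-sequence m tends to infinity because {z m} is compact,
   so the points y converge to x, and their range together with x is a compact
   set contained in no member of the sequence. *)
Lemma k_sequence_locally_compact (R : realType) (X : metricType R) (x : X) :
  k_sequence_property X -> exists2 C, compact C & nbhs x C.
Proof.
move=> kX; apply: contrapT => nC.
have T1 : accessible_space X := hausdorff_accessible (@metric_hausdorff R X).
pose B m := ball x (m.+1%:R^-1 : R).
have BC m C : compact C -> ~ B m `<=` C.
  move=> cC BmC; apply: nC; exists C => //.
  by apply: filterS BmC _; apply: nbhsx_ballx; rewrite invr_gt0.
have [z [_ zC]] := @k_sequence_avoid X (B 0) T1 kX (BC 0).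
pose U := [set A : set X | exists m y,
  B m y /\ A = ~` [set z m] `&` ~` [set y]].
have [|u [Uu uC]] := kX U.
  split=> [_ [m [y [_ ->]]]|C cC].
    by apply: openI; rewrite openC; exact: accessible_closed_set1.
  have [m _ /(_ m (leqnn m)) nCz] := zC C cC.
  have /existsNP[y /not_implyP[By nCy]] := BC m C cC.
  exists (~` [set z m] `&` ~` [set y]); first by exists m, y.
  by move=> c Cc; split=> cE; rewrite cE in Cc.
have /choice[m /choice[y myP]] : forall n, exists m y,
    B m y /\ u n = ~` [set z m] `&` ~` [set y].
  by move=> n; have := Uu n.
have m_infty N : \forall n \near \oo, (N <= m n)%N.
  have zN : \forall n \near \oo, forall i : 'I_N, u n (z i).
    apply: (@filter_forall _ _ (fun (i : 'I_N) n => u n (z i))) => i.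
    by apply: filterS (uC _ (@compact_set1 _ (z i))) => n; exact.
  apply: filterS zN => n zu; rewrite leqNgt; apply/negP => mN.
  by have := zu (Ordinal mN); have [_ ->] := myP n; case=> /(_ erefl).
have yx : y @ \oo --> x.
  apply/cvg_ballP => e e0.
  apply: filterS (m_infty (Num.truncn e^-1)) => n mn.
  have [Byn _] := myP n; apply: le_ball Byn.
  rewrite -[leRHS]invrK lef_pV2 ?posrE ?invr_gt0//.
  by rewrite (le_trans (ltW (truncnS_gt _)))// ler_nat.
have [N _ /(_ N (leqnn N)) /(_ (y N))] := uC _ (@compact_range_cvg _ _ _ yx).
have [_ ->] := myP N.
by move=> /(_ (or_intror (ex_intro2 _ _ N I erefl)))[_ /(_ erefl)].
Qed.

Lemma k_sequence_hemicompact (R : realType) (X : metricType R) :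
  k_sequence_property X -> hemicompact X.
Proof.
move=> kX.
have [|u [Uu uC]] := kX [set A | open A /\ exists2 C, compact C & A `<=` C].
  split=> [A []//|K cK].
  (* Each point has a compact neighbourhood, whose interior stays inside that of any larger compact
     set; near-covering compactness of [K] then yields one [C] for all points. *)
  have : \forall C \near compact_cofinal X, K `<=` C^°.
    apply: (compact_near_coveringP _).1 cK _ _ (fun C => C^°) _ _ => x Kx.
    have [C cC xC] := @k_sequence_locally_compact R X x kX.
    exists (C^°, [set D | compact D /\ C `<=` D]) => /=.
      by split; [exact: nbhs_interior | exists C].
    by move=> [x' D] [/= Cx' [_ CD]]; exact: interiorS Cx'.
  move=> [C cC /(_ C (conj cC (@subset_refl _ C))) KC].
  exists C^° => //; split; first exact: open_interior.
  by exists C => //; exact: interior_subset.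
have /choice[C CP] : forall n, exists C, compact C /\ u n `<=` C.
  by move=> n; have [_ [C cC uC']] := Uu n; exists C.
exists C; split=> [n|K cK]; first by have [] := CP n.
have [N _ /(_ N (leqnn N)) KuN] := uC K cK.
by exists N; have [_ uCN] := CP N; exact: subset_trans uCN.
Qed.

(** * The function space, with [iota] carrying real values into the scalar field *)

Section cts_scalar_field.
Context (R : realType) (X : metricType R) (K : numFieldType) (iota : R -> K)
  (Y : normedModType K).
Context (iota_cts : continuous iota) (iota0 : iota 0 = 0) (iota1 : iota 1 = 1).

(** A Urysohn function, 1 on [C] and 0 off [U], blends [g] with the constant [y]. *)
Lemma cts_interpolation (C U : set X) (g : cts_co X Y) (y : Y) :
  compact C -> open U -> C `<=` U ->
  exists f : cts_co X Y, (forall x, C x -> to_cts f x = to_cts g x) /\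
    (forall x, ~ U x -> to_cts f x = y).
Proof.
move=> cC oU CU.
have : uniform_separator (~` U) C.
  apply: (@normal_separatorP R X).1 => //; first exact: pseudometric_normal.
  - exact: open_closedC.
  - exact: compact_closed (@metric_hausdorff R X) cC.
  - by apply/disjoints_subset; exact: subsetC.
move=> /(@uniform_separatorP _ R)[phi [cphi _ phi0 phi1]].
pose h x := y + iota (phi x) *: (to_cts g x - y).
have ch : continuous h.
  move=> x; apply: cvgD; first exact: cvg_cst.
  apply: cvgZ; last by apply: cvgB; [exact: cts_fun | exact: cvg_cst].
  exact: (continuous_comp (cphi x) (@iota_cts _)).
exists (mkcts ch : continuousType X Y); split=> x xP; rewrite /to_cts/= /mkcts /h.
  have -> : phi x = 1 by apply: phi1; exists x.
  by rewrite iota1 scale1r addrC subrK.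
have -> : phi x = 0 by apply: phi0; exists x.
by rewrite iota0 scale0r addr0.
Qed.

(* For a k-cover U, the functions taking the value y outside some member of U
   are dense.  If a sequence of them converges to 0, then on a given compact
   set its terms eventually avoid y, so that the corresponding members of U
   eventually contain the compact set. *)
Lemma sequentially_dense_k_sequence (y : Y) : y != 0 ->
  (forall S : set (cts_co X Y), dense S -> sequentially_dense S) ->
  k_sequence_property X.
Proof.
move=> y0 seqd U [oU Ucov].
pose S := [set f : cts_co X Y | exists2 A, U A &
  forall x, ~ A x -> to_cts f x = y].
have dS : dense S.
  move=> O [g Og] oO.
  have /choice[f fP] : forall C, exists f : cts_co X Y, compact C ->
      S f /\ forall x, C x -> to_cts f x = to_cts g x.
    move=> C; have [cC|?] := pselect (compact C); last by exists g.
    have [A UA CA] := Ucov C cC.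
    have [f [fg fy]] := cts_interpolation _ _ g y cC (oU A UA) CA.
    by exists f => _; split=> //; exists A.
  (* [f D] agrees with [g] on every compact subset of [D], hence the net converges. *)
  have fg : f @ compact_cofinal X --> g.
    apply/cts_co_cvgP => C V cC oV gV; exists C => // D [cD CD] _ [x Cx <-].
    by have [_ ->] := fP D cD; [apply: gV; exists x | exact: CD].
  have [C cC /(_ C (conj cC (@subset_refl _ C))) OfC] :=
    fg O (open_nbhs_nbhs (conj oO Og)).
  by exists (f C); split=> //; have [] := fP C cC.
have [f [Sf f0]] := seqd S dS (cst 0 : continuousType X Y).
have /choice[A AP] : forall n, exists A, U A /\
    forall x, ~ A x -> to_cts (f n) x = y.
  by move=> n; have [A UA fy] := Sf n; exists A.
exists A; split=> [n|C cC]; first by have [] := AP n.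
have oV : open (~` [set y]).
  rewrite openC; apply: accessible_closed_set1.
  by apply: hausdorff_accessible; exact: norm_hausdorff.
move/cts_co_cvgP : f0 => /(_ C _ cC oV).
have C0 : to_cts (cst 0 : continuousType X Y) @` C `<=` ~` [set y].
  by move=> _ [x _ <-] /= /esym/eqP; exact/negP.
move=> /(_ C0); apply: filterS => n fC x Cx; apply: contrapT => nAx.
have [_ /(_ x nAx) fy] := AP n.
by apply: (fC (to_cts (f n) x)); [exists x | exact: fy].
Qed.

Lemma cts_co_tfae : countable_uniformity Y -> (exists y : Y, y != 0) ->
  [<-> (forall S : set (cts_co X Y), dense S -> sequentially_dense S);
       hemicompact X;
       frechet_urysohn (cts_co X Y)].
Proof.
move=> cuY [y y0]; tfae.
- by move=> /(sequentially_dense_k_sequence _ y0)/k_sequence_hemicompact.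
- exact: hemicompact_frechet_urysohn.
- by move=> FU S; exact: frechet_urysohn_dense.
Qed.

End cts_scalar_field.

Lemma continuous_real_complex (R : realType) :
  continuous (real_complex R : R -> (complex R : numFieldType)).
Proof.
move=> x; apply/cvgrPdist_lt => e; rewrite ltcE /= => /andP[/eqP e1 e0].
near=> t; rewrite -rmorphB normc_def ltcE/= expr0n addr0 sqrtr_sqr e1 eqxx/=.
by near: t; exists (complex.Re e).
Unshelve. all: by end_near. Qed.

(** Positive elements of [complex R] are real, so by the Archimedean property the radii [1/(n+1)]
    suffice. *)
Lemma countable_uniformity_complex_normed (R : realType)
  (Y : normedModType (complex R)) : countable_uniformity Y.
Proof.
apply/countable_uniformityP.
exists (fun n => [set xy : Y * Y | ball xy.1 (n.+1%:R^-1)%:C%C xy.2]); last first.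
  move=> n; have n0 : 0 < (n.+1%:R^-1)%:C%C :> complex R.
    by rewrite ltcR invr_gt0 ltr0n.
  exact: (entourage_ball Y (PosNum n0)).
move=> E; rewrite -entourage_ballE => -[e + subE].
rewrite /= ltcE => /andP[/eqP e1 e0].
exists (Num.truncn (complex.Re e)^-1); apply: subset_trans subE => xy.
apply: le_ball.
rewrite lecE /= e1 eqxx/=.
by rewrite -[leRHS]invrK lef_pV2 ?posrE ?invr_gt0// ltW// truncnS_gt.
Qed.

Theorem theorem2p11 (R : realType) (X : metricType R) :
  (forall Y : normedModType R, (exists y : Y, y != 0) ->
    [<-> (forall S : set (cts_co X Y), dense S -> sequentially_dense S);
         hemicompact X;
         frechet_urysohn (cts_co X Y)])
  /\
  (forall Y : normedModType (complex R), (exists y : Y, y != 0) ->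
    [<-> (forall S : set (cts_co X Y), dense S -> sequentially_dense S);
         hemicompact X;
         frechet_urysohn (cts_co X Y)]).
Proof.
split=> Y.
  apply: (@cts_co_tfae R X R (@idfun R) Y (fun x => cvg_id)) => //.
  exact: countable_uniformity_metric.
apply: (@cts_co_tfae R X (complex R) (real_complex R) Y) => //.
  exact: continuous_real_complex.
exact: countable_uniformity_complex_normed.
Qed.
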